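(* Let $\mathcal{M}$ be a matroid with set of bases $\mathcal{B}$. Then $\mathcal{M}$ has a minor $\mathcal{M}'$ isomorphic to the uniform matroid $\mathcal{U}_{3,6}$ if and only if $\Delta_{\{B_1,B_2\}}=10$ for some $B_1,B_2\in\mathcal{B}$.
   Context: $\mathcal{U}_{3,6}$ is the uniform matroid of rank $3$ on $6$ elements. A minor of $\mathcal{M}$ is a matroid $(\mathcal{M}\setminus A)/C$ with $A,C$ disjoint subsets of the ground set. For bases $B_1,B_2$ of $\mathcal{M}$, $\Delta_{\{B_1,B_2\}}$ is the number of unordered pairs $\{D_1,D_2\}$ with $D_1,D_2\in\mathcal{B}$ such that $D_1\cup D_2=B_1\cup B_2$ as multisets. *)

(* Defs.v *)
From mathcomp Require Import all_boot.
Set Implicit Arguments. Unset Strict Implicit. Unset Printing Implicit Defensive.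

Definition is_matroid (T : finType) (E : {set T}) (Bs : {set {set T}}) : Prop :=
  [/\ Bs != set0,
      (forall B, B \in Bs -> B \subset E) &
      (forall B1 B2, B1 \in Bs -> B2 \in Bs -> forall x, x \in B1 :\: B2 ->
         exists2 y, y \in B2 :\: B1 & (y |: (B1 :\ x)) \in Bs)].

Definition del_bases (T : finType) (Bs : {set {set T}}) (A : {set T}) : {set {set T}} :=
  [set B :\: A | B in [set B in Bs | [forall B' in Bs, #|B' :\: A| <= #|B :\: A|]]].

Definition con_bases (T : finType) (Bs : {set {set T}}) (C : {set T}) : {set {set T}} :=
  [set B :\: C | B in [set B in Bs | [forall B' in Bs, #|B' :&: C| <= #|B :&: C|]]].

Definition minor_ground (T : finType) (E A C : {set T}) : {set T} := E :\: (A :|: C).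
Definition minor_bases (T : finType) (Bs : {set {set T}}) (A C : {set T}) : {set {set T}} :=
  con_bases (del_bases Bs A) C.

Definition uniform_bases (r n : nat) : {set {set 'I_n}} := [set S : {set 'I_n} | #|S| == r].

Definition iso_uniform (T : finType) (r n : nat) (E : {set T}) (Bs : {set {set T}}) : Prop :=
  exists f : 'I_n -> T,
    [/\ injective f, f @: [set: 'I_n] = E &
        Bs = [set f @: S | S : {set 'I_n} in uniform_bases r n]].

Definition multiset_eq (T : finType) (D1 D2 B1 B2 : {set T}) : bool :=
  [forall x, (x \in D1) + (x \in D2) == (x \in B1) + (x \in B2)].

Definition Delta (T : finType) (Bs : {set {set T}}) (B1 B2 : {set T}) : nat :=
  #|[set [set D1; D2] | D1 in Bs, D2 in Bs & multiset_eq D1 D2 B1 B2]|.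

(* Main.v *)
From Stdlib Require Import NArith.
Require Import Defs.
From mathcomp Require Import all_boot zify.
Set Implicit Arguments. Unset Strict Implicit. Unset Printing Implicit Defensive.

(** Put I = B1 :&: B2, let U be the symmetric difference of B1 and B2, and
    k = #|B1 :\: B2|, so that #|U| = 2k.  If k > 0, then Delta Bs B1 B2 counts
    the sets S in U, containing a fixed x in B1 :\: B2, such that I :|: S and
    I :|: (U :\: S) are both bases.  There are at most 'C(2k - 1, k - 1) of
    them, which is below 10 for k <= 2 and equal to 10 for k = 3; hence for
    k = 3, Delta = 10 exactly when every 3-subset of U extends I to a basis,
    i.e. when deleting the complement of B1 :|: B2 and contracting I gives
    U_{3,6}.
    By multiple symmetric exchange the family of all such S (for every x)
    shatters each of its members, so there are at least 2 ^ (k - 1) >= 16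
    pairs if k >= 5.  For k = 4, a family of 4-subsets of an 8-set that is
    closed under complement and shatters each of its members never has exactly
    20 members; this finite statement is decided by a verified search. *)

(** * Backtracking search for sets of prescribed size hitting all clauses *)

Definition bit (c : N) (i : nat) : bool := N.testbit c (N.of_nat i).

Definition mask_of (n : nat) (P : pred nat) : N :=
  foldr (fun i c => if P i then N.setbit c (N.of_nat i) else c) 0%num (iota 0 n).

Definition meets (c d : N) : bool := ~~ N.eqb (N.land c d) 0.

(* Unmet clauses that are pairwise disjoint need distinct hitting elements. *)
Fixpoint greedy (used : N) (cls : seq N) : nat :=
  if cls is c :: cls' then
    if meets c used then greedy used cls' else (greedy (N.lor c used) cls').+1
  else 0.

Definition bits (n : nat) (c : N) : seq nat := [seq i <- iota 0 n | bit c i].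

(** Only a heuristic to keep the branching small: soundness uses no more than the membership of the
    result in [c :: cls]. *)
Fixpoint shortest (n : nat) (c : N) (cls : seq N) : N :=
  if cls is d :: cls' then
    shortest n (if size (bits n d) < size (bits n c) then d else c) cls'
  else c.

(** Once the case where [v] is chosen has been refuted, the later cases may assume that [v] is not
    chosen, so [v] leaves [U] for good and no set is explored twice. *)
Fixpoint branch (f : nat -> N -> bool) (vs : seq nat) (U : N) : bool :=
  if vs is v :: vs' then
    let U' := N.clearbit U (N.of_nat v) in
    if f v U' then branch f vs' U' else false
  else true.

(* [T] holds the t elements chosen so far, [U] the undecided ones.  Once every
   clause is met and t < k, some element of [U] must still be chosen, so [U]
   itself serves as the clause to branch on. *)
Fixpoint refute (n k : nat) (rules : seq (seq N))
    (fuel t : nat) (T U : N) (cls : seq N) : bool :=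
  if fuel is fuel'.+1 then
    let act := [seq N.land c U | c <- cls & ~~ meets c T] in
    if k < t + greedy T act then true else
    if nilp act && (k <= t) then false else
    branch (fun v U' =>
        refute n k rules fuel' t.+1 (N.setbit T (N.of_nat v)) U'
          (nth [::] rules v ++ act))
      (bits n (shortest n U act)) U
  else false.

Lemma bit_land c d i : bit (N.land c d) i = bit c i && bit d i.
Proof. by rewrite /bit N.land_spec. Qed.

Lemma bit_lor c d i : bit (N.lor c d) i = bit c i || bit d i.
Proof. by rewrite /bit N.lor_spec. Qed.

Lemma bit_setbit c i j : bit (N.setbit c (N.of_nat i)) j = (i == j) || bit c j.
Proof. by rewrite /bit N.setbit_eqb; congr (_ || _); apply/N.eqb_spec/eqP; lia. Qed.

Lemma bit_clearbit c i j :
  bit (N.clearbit c (N.of_nat i)) j = bit c j && (i != j).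
Proof.
by rewrite /bit N.clearbit_eqb; congr (_ && ~~ _); apply/N.eqb_spec/eqP; lia.
Qed.

Lemma bit_mask_of n P i : bit (mask_of n P) i = (i < n) && P i.
Proof.
rewrite /mask_of -[i < n]/(0 <= i < 0 + n) -mem_iota.
elim: (iota 0 n) => [|j s IHs] /=; first by [].
case: ifPn => Pj; rewrite ?bit_setbit IHs inE [i == j]eq_sym;
  by case: eqP => // <-; rewrite ?Pj ?(negbTE Pj) ?andbF.
Qed.

Lemma meetsPn c d i : ~~ meets c d -> bit c i -> bit d i = false.
Proof.
rewrite negbK => /N.eqb_spec cd0 ci; apply/negbTE/negP => di.
by have := bit_land c d i; rewrite cd0 ci di /bit N.bits_0.
Qed.

Lemma shortest_mem n c cls : shortest n c cls \in c :: cls.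
Proof.
elim: cls c => [|d cls IHcls] c /=; first by rewrite inE.
have := IHcls (if size (bits n d) < size (bits n c) then d else c).
by case: ifP => _; rewrite !inE => /orP[->|->]; rewrite ?orbT.
Qed.

Lemma count_setbit c v s : uniq s -> v \in s -> ~~ bit c v ->
  count (bit (N.setbit c (N.of_nat v))) s = (count (bit c) s).+1.
Proof.
move=> uniq_s v_s Ncv; rewrite -add1n -[1]/(nat_of_bool true) -v_s.
rewrite -count_uniq_mem // -count_predUI.
rewrite [X in _ = _ + X](@eq_count _ _ pred0) ?count_pred0 ?addn0; last first.
  by move=> i /=; case: eqP => // ->; apply/negbTE.
by apply: eq_count => i; rewrite bit_setbit eq_sym.
Qed.

(** * Soundness of the search *)

Section RefuteSound.
Variables (n k : nat) (rules : seq (seq N)) (p : pred nat).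

Definition hit (c : N) : bool := has (fun i => p i && bit c i) (iota 0 n).

Lemma hitP c : reflect (exists i, [/\ i < n, p i & bit c i]) (hit c).
Proof.
apply: (iffP hasP) => [[i]|[i [ltin pi ci]]].
  by rewrite mem_iota => ltin /andP[pi ci]; exists i.
by exists i; rewrite ?mem_iota ?pi.
Qed.

(** A counted clause contains an element of [p] outside [used]; adding the clause to [used] removes
    that element from the right-hand count, which thus drops at every step counted. *)
Lemma greedy_count used cls : all hit cls ->
  greedy used cls <= count (fun i => p i && ~~ bit used i) (iota 0 n).
Proof.
elim: cls used => //= c cls IHcls used /andP[/hitP[i [ltin pi ci]] /IHcls le_cls].
case: ifPn => // Nmeet; apply: leq_ltn_trans (le_cls _) _.
have ui := meetsPn Nmeet ci.
rewrite -!size_filter; apply: (@leq_trans (size (i ::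
  [seq j <- iota 0 n | p j & ~~ bit (N.lor c used) j]))) => //.
apply: uniq_leq_size.
  by rewrite /= filter_uniq ?iota_uniq // andbT mem_filter bit_lor ci andbF.
move=> j; rewrite inE => /predU1P[->|]; rewrite !mem_filter mem_iota ?pi ?ui //.
by rewrite bit_lor negb_or => /andP[/and3P[-> _ ->]].
Qed.

Hypothesis rules_hit : forall i, i < n -> p i -> all hit (nth [::] rules i).
Hypothesis count_p : count p (iota 0 n) = k.

(** The set [p] is itself a solution, and the invariants say that it contains [T], lies in the union
    of [T] and [U], and that these two are disjoint. The clause branched on contains an element of
    [p], and the first such branch inherits the invariants, so it cannot be refuted. *)
Lemma refute_sound fuel t T U cls :
  (forall i, i < n -> bit T i -> p i) ->
  (forall i, i < n -> p i -> ~~ bit T i -> bit U i) ->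
  (forall i, bit U i -> ~~ bit T i) ->
  count (bit T) (iota 0 n) = t ->
  all hit cls -> ~~ refute n k rules fuel t T U cls.
Proof.
elim: fuel t T U cls => //= fuel IHfuel t T U cls Tp pTU UT cntT hits.
set act := [seq _ | _ <- _ & _].
have act_hit : all hit act.
  apply/allP=> _ /mapP[c + ->]; rewrite mem_filter => /andP[cT c_cls].
  have /hitP[i [ltin pi ci]] := allP hits c c_cls; apply/hitP; exists i.
  by rewrite bit_land ci pTU // (meetsPn cT).
have act_U c i : c \in act -> bit c i -> bit U i.
  by move=> /mapP[d _ ->]; rewrite bit_land => /andP[].
(* With this splitting, [greedy_count] shows that the pruning test [k < t + greedy T act] fails. *)
have cnt_split : k = t + count (fun i => p i && ~~ bit T i) (iota 0 n).
  rewrite -count_p -cntT -(count_predUI (bit T)) -[LHS]addn0; congr (_ + _).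
    apply: eq_in_count => i; rewrite mem_iota /= => ltin.
    by case Ti: (bit T i); rewrite ?andbT // Tp.
  by rewrite (@eq_count _ _ pred0) ?count_pred0 // => i /=; case: (bit T i); rewrite ?andbF.
rewrite cnt_split ltn_add2l ltnNge greedy_count //= -cnt_split.
case: ifP => // act_or_t.
set c := shortest n U act.
(* If the clause is [U] itself, it is hit either through some active clause, which lies in [U], or
   because [t < k] leaves an element of [p] undecided. *)
have [cU hit_c] : (forall i, bit c i -> bit U i) /\ hit c.
  have: c \in U :: act by apply: shortest_mem.
  rewrite inE => /predU1P[-> | c_act]; last first.
    by split=> [i|]; [apply: act_U | apply: (allP act_hit)].
  split=> //; case: (posnP (size act)) => [act0|]; last first.
    case: (act) act_hit act_U => //= d act' /andP[/hitP[i [ltin pi di]] _] act_U _.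
    by apply/hitP; exists i; rewrite (act_U d) ?mem_head.
  move: act_or_t; rewrite /nilp act0 /= => /negbT; rewrite -ltnNge {1}cnt_split.
  rewrite -{1}[t]addn0 ltn_add2l -has_count => /hasP[i].
  by rewrite mem_iota => ltin /andP[pi NTi]; apply/hitP; exists i; rewrite pTU.
have: has p (bits n c).
  have /hitP[i [ltin pi ci]] := hit_c.
  by apply/hasP; exists i; rewrite // mem_filter ci mem_iota.
have: uniq (bits n c) by rewrite filter_uniq ?iota_uniq.
have: all (fun i => (i < n) && bit U i) (bits n c).
  by apply/allP=> i; rewrite mem_filter mem_iota => /andP[/cU Ui /= ltin]; rewrite ltin.
move: (bits n c) => vs; clear c cU hit_c; clearbody act.
elim: vs U pTU UT {act_U act_or_t} => //= v vs IHvs U pTU UT.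
move=> /andP[/andP[ltvn Uv] vsU] /andP[v_vs uniq_vs] has_p.
case: ifPn => // reft.
have Npv : ~~ p v.
  apply: contraL reft => pv; apply: IHfuel.
  - by move=> i ltin; rewrite bit_setbit => /predU1P[<- | /Tp->].
  - move=> i ltin pi; rewrite bit_setbit bit_clearbit negb_or => /andP[-> NTi].
    by rewrite pTU.
  - move=> i; rewrite bit_setbit bit_clearbit negb_or => /andP[Ui ->].
    exact: UT.
  - by rewrite count_setbit ?cntT ?mem_iota ?iota_uniq ?UT.
  - by rewrite all_cat rules_hit.
apply: IHvs => //.
- move=> i ltin pi NTi; rewrite bit_clearbit pTU //=.
  by apply: contraNneq Npv => ->.
- by move=> i; rewrite bit_clearbit => /andP[/UT].
- apply/allP=> i i_vs; have /andP[-> Ui] := allP vsU i i_vs.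
  by rewrite bit_clearbit Ui; apply: contraNneq v_vs => ->.
- by move: has_p; rewrite (negbTE Npv).
Qed.
End RefuteSound.

(** * Families of halves that shatter their members *)

Fixpoint submasks (m : bitseq) : seq bitseq :=
  if m is b :: m' then
    let r := submasks m' in
    map (cons false) r ++ (if b then map (cons true) r else [::])
  else [:: [::]].

Definition meet (a b : bitseq) : bitseq := [seq x.1 && x.2 | x <- zip a b].

(* One representative, the one containing element 0, of each partition of 2k
   elements into two halves. *)
Definition halves (k : nat) : seq bitseq :=
  [seq m <- map (cons true) (submasks (nseq (k.*2).-1 true)) | count id m == k].

(** Clauses triggered by choosing a half [m], written as sets of indices into [halves k]: each
    subset of [m] must be the trace of a chosen half or of its complement. Choosing [m] also puts
    its complement in the family, which triggers the same demands. *)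
Definition trace_rules (k : nat) : seq (seq N) :=
  let hs := halves k in
  let rules m :=
    [seq mask_of (size hs) (fun j => let d := nth [::] hs j in
           (meet d m == a) || (meet (map negb d) m == a)) | a <- submasks m] in
  [seq undup (rules m ++ rules (map negb m)) | m <- hs].

Lemma mem_map_cons (b c : bool) (m : bitseq) (s : seq bitseq) :
  (b :: m \in map (cons c) s) = (b == c) && (m \in s).
Proof.
apply/mapP/andP => [[x xs [-> ->]]|[/eqP-> ms]]; last by exists m.
by rewrite eqxx.
Qed.

Lemma mem_submasks a m :
  (a \in submasks m) = (size a == size m) && (meet a m == a).
Proof.
elim: m a => [|b m IHm] [|c a] //=.
  by rewrite mem_cat; case: b => //=; apply/negbTE/norP; split=> //;
    apply/mapP => -[].
rewrite mem_cat mem_map_cons eqSS /meet /= eqseq_cons -/(meet a m).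
by case: b; case: c; rewrite ?mem_map_cons ?in_nil ?IHm /= ?orbF ?andbF.
Qed.

Lemma mem_halves k m : 0 < k ->
  (m \in halves k) = [&& size m == k.*2, head false m & count id m == k].
Proof.
case: k => // k _; rewrite mem_filter andbC.
case: m => [|b m]; first by case: mapP => [[]|].
rewrite mem_map_cons mem_submasks size_nseq eqb_id doubleS succnK.
rewrite [size (b :: m)]/= eqSS; case: (size m =P _) => [<-|_]; last by rewrite andbF.
suff -> : meet m (nseq (size m) true) = m by rewrite eqxx !andbT.
by elim: m => //= c m IHm; rewrite /meet /= -/(meet _ _) IHm andbT.
Qed.

Lemma halves_complement k m : 0 < k -> size m = k.*2 -> count id m = k ->
  m \in halves k \/ map negb m \in halves k.
Proof.
move=> k_gt0 size_m cnt_m; rewrite !mem_halves // size_map size_m eqxx cnt_m /=.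
case: m size_m cnt_m => [|[] m] /= size_m cnt_m; first by move: k_gt0; rewrite -cnt_m.
  by left; rewrite eqxx.
right; rewrite count_map add1n; apply/eqP/(@addnI k).
rewrite addnn -size_m -(count_predC id m) -cnt_m add0n addnS.
by congr (_ + _).+1; apply: eq_count.
Qed.

Lemma count_nth_iota (A : Type) (x : A) (a : pred A) s :
  count (fun i => a (nth x s i)) (iota 0 (size s)) = count a s.
Proof. by rewrite -[in RHS](mkseq_nth x s) count_map. Qed.

Section Shattered.
Variable p : pred bitseq.
Hypothesis p_negb : forall m, size m = 8 -> p (map negb m) = p m.
Hypothesis p_count : forall m, size m = 8 -> p m -> count id m = 4.
Hypothesis p_trace : forall m a, size m = 8 -> p m -> a \in submasks m ->
  exists m', [/\ size m' = 8, p m' & meet m' m = a].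

(** Shattering provides a member [m'] with the wanted trace; [m'] or its complement is the listed
    representative, which accounts for the disjunction in the clauses. *)
Lemma trace_rules_hit i : i < size (halves 4) -> p (nth [::] (halves 4) i) ->
  all (hit (size (halves 4)) (fun j => p (nth [::] (halves 4) j)))
    (nth [::] (trace_rules 4) i).
Proof.
move=> lti; rewrite (nth_map [::]) //; have := mem_nth [::] lti.
set m := nth _ _ _; rewrite mem_halves // => /and3P[/eqP size_m _ _] pm.
have key m1 : size m1 = 8 -> p m1 -> forall a, a \in submasks m1 ->
   hit (size (halves 4)) (fun j => p (nth [::] (halves 4) j))
     (mask_of (size (halves 4)) (fun j => let d := nth [::] (halves 4) j in
           (meet d m1 == a) || (meet (map negb d) m1 == a))).
  move=> size_m1 pm1 a a_m1.
  have [m' [size_m' pm' m'a]] := p_trace size_m1 pm1 a_m1.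
  have [h [h_in ph mh]] : exists h, [/\ h \in halves 4, p h &
      (meet h m1 == a) || (meet (map negb h) m1 == a)].
    case: (@halves_complement 4 m' isT size_m' (p_count size_m' pm')) => m'h.
      by exists m'; rewrite m'a eqxx.
    exists (map negb m'); rewrite p_negb // mapK ?m'a ?eqxx ?orbT //.
    exact: negbK.
  apply/hitP; exists (index h (halves 4)); rewrite bit_mask_of index_mem h_in.
  by rewrite nth_index.
apply/allP => c; rewrite mem_undup mem_cat => /orP[] /mapP[a a_in ->].
  exact: key.
by apply: key => //; rewrite ?size_map ?p_negb.
Qed.

Lemma count_halves_neq10 :
  p [:: true; true; true; true; false; false; false; false] ->
  count p (halves 4) != 10.
Proof.
set m0 := [:: true; _; _; _; _; _; _; _] => pm0; apply/eqP => cnt10.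
(* There are 35 = 'C(7, 3) representatives. As [m0] is known to be in the family, the search starts
   with it alone chosen, and fuel 12 covers the growth from 1 to 10 chosen halves. *)
pose T := mask_of 35 (pred1 (index m0 (halves 4))).
pose U := mask_of 35 (predC1 (index m0 (halves 4))).
have size_h : size (halves 4) = 35 by [].
have : refute 35 10 (trace_rules 4) 12 1 T U
         (nth [::] (trace_rules 4) (index m0 (halves 4))) by vm_compute.
apply/negP; apply: (@refute_sound _ _ _ (fun j => p (nth [::] (halves 4) j))).
- by rewrite -size_h; apply: trace_rules_hit.
- by rewrite -size_h count_nth_iota.
- by move=> i _; rewrite bit_mask_of => /andP[_ /eqP->]; rewrite nth_index.
- by move=> i lti _; rewrite !bit_mask_of lti.
- by move=> i; rewrite !bit_mask_of => /andP[_ Ni]; apply/nandP; right.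
- by [].
- by rewrite -{1}size_h; apply: trace_rules_hit.
Qed.
End Shattered.

(** * Rank, multiple exchange and minors *)

Section Matroid.
Variables (T : finType) (E : {set T}) (Bs : {set {set T}}).
Hypothesis M : is_matroid E Bs.
Implicit Types (A B C D I P Q S U X Y : {set T}) (x y v : T).

Lemma exchange_card B B' x y : x \in B :\: B' -> y \in B' :\: B ->
  #|y |: (B :\ x)| = #|B| /\ #|B :\: B'| = #|(y |: (B :\ x)) :\: B'|.+1.
Proof.
rewrite !inE => /andP[xB' xB] /andP[yB yB']; split.
  by rewrite cardsU1 !inE (negbTE yB) andbF (cardsD1 x B) xB.
rewrite (cardsD1 x (B :\: B')) !inE xB' xB add1n; congr _.+1.
apply: eq_card => z; rewrite !inE; case: (eqVneq z y) => [->|_]; last by case: (z == x); rewrite ?andbF.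
by rewrite yB' (negbTE yB) !andbF.
Qed.

Lemma base_card B B' : B \in Bs -> B' \in Bs -> #|B| = #|B'|.
Proof.
have [_ _ exch] := M; move: {2}#|_| (erefl #|B :\: B'|) => n.
elim: n B => [|n IHn] B nE B_in B'_in.
  suff -> : B = B' by [].
  apply/eqP; rewrite eqEsubset -!setD_eq0 -cards_eq0 nE eqxx /=.
  (* An element of [B'] outside [B] would need a partner in [B :\: B'], which is empty. *)
  apply/set0Pn => -[x /(exch _ _ B'_in B_in)[y]].
  by move/eqP: nE; rewrite cards_eq0 => /eqP->; rewrite inE.
have /card_gt0P[x xBB'] : 0 < #|B :\: B'| by rewrite nE.
have [y yB'B /IHn] := exch _ _ B_in B'_in x xBB'.
have [-> ] := exchange_card xBB' yB'B.
by rewrite nE => -[<-]; apply.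
Qed.

(** The usual matroid rank, since the independent subsets of [X] are the subsets of the sets
    [B :&: X]; this form needs bases only. *)
Definition rank X : nat := \max_(B in Bs) #|B :&: X|.

Lemma rank_ge B X : B \in Bs -> #|B :&: X| <= rank X.
Proof. exact: (@leq_bigmax_cond _ (mem Bs) (fun B => #|B :&: X|)). Qed.

Lemma rank_attained X : exists2 B, B \in Bs & #|B :&: X| = rank X.
Proof.
have [Bs0 _ _] := M.
have [|B B_in rB] := @eq_bigmax_cond _ (mem Bs) (fun B => #|B :&: X|).
  by rewrite card_gt0.
by exists B; last exact/esym.
Qed.

(** Start from a base attaining the rank of [X] and move it towards one attaining the rank of [Y].
    While the former meets [Y] in too few elements, it has an element outside [Y] to exchange, and
    giving this up does not shrink its part in [X]. *)
Lemma rank_chain X Y : X \subset Y ->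
  exists B, [/\ B \in Bs, #|B :&: X| = rank X & #|B :&: Y| = rank Y].
Proof.
move=> sXY; have [_ _ exch] := M.
have [B' B'_in rB'] := rank_attained Y; have [B B_in rB] := rank_attained X.
move: {2}#|_| (erefl #|B :\: B'|) => n.
elim: n B B_in rB => [|n IHn] B B_in rB nE.
  exists B; split=> //; suff -> : B = B' by [].
  apply/eqP; rewrite eqEcard (base_card B_in B'_in) leqnn andbT.
  by rewrite -setD_eq0 -cards_eq0 nE.
case: (ltngtP #|B :&: Y| (rank Y)); first 1 last.
- by rewrite ltnNge rank_ge.
- by exists B.
move=> ltYr; have ltD : #|B' :\: Y| < #|B :\: Y|.
  by move: ltYr; rewrite -rB'; have := cardsID Y B; have := cardsID Y B'; rewrite (base_card B_in B'_in); lia.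
have /subsetPn[x] : ~~ (B :\: Y \subset B' :\: Y).
  by apply: contraTN ltD => /subset_leq_card; rewrite leqNgt.
rewrite !inE => /andP[xY xB]; rewrite xY /= => xB'.
have xBB' : x \in B :\: B' by rewrite inE xB'.
have [y yB'B By_in] := exch _ _ B_in B'_in x xBB'.
have [_ cardD] := exchange_card xBB' yB'B.
apply: (IHn _ By_in); last by move: cardD; rewrite nE => -[].
apply/eqP; rewrite eqn_leq rank_ge // -rB subset_leq_card //.
apply/subsetP => z; rewrite !inE => /andP[zB zX]; rewrite zB zX !andbT.
by apply/orP; right; apply: contraNneq xY => <-; apply: (subsetP sXY).
Qed.

(** One base attains the ranks of both the intersection and the union, and the size of its part in a
    set is modular. *)
Lemma rank_submodular X Y :
  rank (X :|: Y) + rank (X :&: Y) <= rank X + rank Y.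
Proof.
have sIU : X :&: Y \subset X :|: Y by rewrite subIset ?subsetUl.
have [B [B_in <- <-]] := rank_chain sIU.
by rewrite setIUr setIIr cardsUI leq_add ?rank_ge.
Qed.

Lemma rank_mono X Y : X \subset Y -> rank X <= rank Y.
Proof.
move=> sXY; have [B B_in <-] := rank_attained X.
by rewrite (leq_trans _ (rank_ge Y B_in)) // subset_leq_card // setIS.
Qed.

Lemma rank_le_card X : rank X <= #|X|.
Proof. by have [B _ <-] := rank_attained X; rewrite subset_leq_card // subsetIr. Qed.

Lemma rank_le_base B X : B \in Bs -> rank X <= #|B|.
Proof.
move=> B_in; have [B' B'_in <-] := rank_attained X.
by rewrite (base_card B_in B'_in) subset_leq_card // subsetIl.
Qed.

Lemma rank_independent B X : B \in Bs -> X \subset B -> rank X = #|X|.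
Proof.
move=> B_in sXB; apply/eqP; rewrite eqn_leq rank_le_card.
by rewrite -{1}(setIidPr sXB) rank_ge.
Qed.

Lemma rank_spanning B X : B \in Bs -> B \subset X -> rank X = #|B|.
Proof.
move=> B_in sBX; apply/eqP; rewrite eqn_leq rank_le_base //.
by rewrite -{1}(setIidPl sBX) rank_ge.
Qed.

Lemma rank_base B X : B \in Bs -> #|X| <= #|B| -> #|B| <= rank X -> X \in Bs.
Proof.
move=> B_in leXB; have [B' B'_in <-] := rank_attained X.
rewrite (base_card B_in B'_in) in leXB *.
move=> leB'; have sB'X : B' \subset X.
  by apply/setIidPl/eqP; rewrite eqEcard subsetIl.
by have /eqP <- : B' == X by rewrite eqEcard sB'X.
Qed.

(* Follows Rado's proof of his transversal theorem: an element of [B] may at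
   first go to either side, and by submodularity of the rank one of its two
   options can be dropped while keeping the Hall-type condition [ok]. *)
Lemma multiple_exchange A1 A2 B :
  [disjoint A1 & A2] -> A1 :|: A2 \in Bs -> B \in Bs ->
  exists P, [/\ P \subset B, A1 :|: P \in Bs, A2 :|: (B :\: P) \in Bs,
    [disjoint A1 & P] & [disjoint A2 & B :\: P]].
Proof.
move=> dA A_in B_in; set b := #|A1 :|: A2|.
pose ok P Q := [forall X : {set T}, (X \subset B) ==>
  (b + #|X| <= rank (A1 :|: (X :&: P)) + rank (A2 :|: (X :&: Q)))].
have okE P Q : reflect (forall X, X \subset B ->
    b + #|X| <= rank (A1 :|: (X :&: P)) + rank (A2 :|: (X :&: Q))) (ok P Q).
  by apply: (iffP forallP) => okPQ X; [apply/implyP | apply/implyP/okPQ].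
(* Submodularity for [A1 :|: X] and [A2 :|: X]: their union spans, and their intersection contains
   the independent set [X]. *)
have okBB : ok B B.
  apply/okE => X sXB; rewrite (setIidPl sXB) addnC.
  apply: leq_trans (rank_submodular _ _); rewrite addnC leq_add //.
    by rewrite (rank_spanning A_in) // setUACA setUid subsetUl.
  by rewrite -(rank_independent B_in sXB) rank_mono // subsetI !subsetUr.
have [P [Q [sPB QE /okE okPQ]]] : exists P Q, [/\ P \subset B, Q = B :\: P & ok P Q].
  suff [P [Q [PUQ PIQ okPQ]]] : exists P Q, [/\ P :|: Q = B, P :&: Q = set0 & ok P Q].
    exists P, Q; rewrite -PUQ subsetUl setDUl setDv set0U; split=> //.
    by apply/esym/setDidPl; rewrite -setI_eq0 setIC PIQ.
  suff gen n P Q : #|P :&: Q| = n -> P :|: Q = B -> ok P Q ->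
      exists P' Q', [/\ P' :|: Q' = B, P' :&: Q' = set0 & ok P' Q'].
    by apply: (gen _ B B (erefl _)); rewrite ?setUid.
  elim: n P Q => [|n IHn] P Q nE PUQ okPQ.
    by exists P, Q; split=> //; apply/eqP; rewrite -cards_eq0 nE.
  have /card_gt0P[v] : 0 < #|P :&: Q| by rewrite nE.
  rewrite inE => /andP[vP vQ].
  case: (boolP (ok (P :\ v) Q)) => [|/forallPn[X]].
    apply: IHn; first by move: nE; rewrite (cardsD1 v) inE vP vQ setIDAC => -[].
    rewrite -PUQ; apply/setP => z; rewrite !inE.
    by case: eqP => // ->; rewrite vQ !orbT.
  case: (boolP (ok P (Q :\ v))) => [|/forallPn[Y]].
    move=> ok1 _; apply: IHn ok1.
      by move: nE; rewrite (cardsD1 v) inE vP vQ setIDA => -[].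
    rewrite -PUQ; apply/setP => z; rewrite !inE.
    by case: eqP => // ->; rewrite vP.
  rewrite !negb_imply -!ltnNge => /andP[sYB ltY] /andP[sXB ltX].
  have vX : v \in X.
    apply: contraLR ltX => vX; rewrite -leqNgt.
    suff -> : X :&: (P :\ v) = X :&: P by move/okE: okPQ; apply.
    apply/setP => z; rewrite !inE; case: eqP => // ->.
    by rewrite (negbTE vX).
  have vY : v \in Y.
    apply: contraLR ltY => vY; rewrite -leqNgt.
    suff -> : Y :&: (Q :\ v) = Y :&: Q by move/okE: okPQ; apply.
    apply/setP => z; rewrite !inE; case: eqP => // ->.
    by rewrite (negbTE vY).
  (* The failures at [X] and [Y] bound the four ranks by 2b + |X| + |Y| - 2 in total, whereas
     [ok P Q] at [X :|: Y] and at [(X :&: Y) :\ v] forces at least 2b + |X| + |Y| - 1. *)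
  have sub1 := rank_submodular (A1 :|: (X :&: (P :\ v))) (A1 :|: (Y :&: P)).
  have sub2 := rank_submodular (A2 :|: (X :&: Q)) (A2 :|: (Y :&: (Q :\ v))).
  have U1 : rank (A1 :|: ((X :|: Y) :&: P)) <=
      rank ((A1 :|: (X :&: (P :\ v))) :|: (A1 :|: (Y :&: P))).
    apply/rank_mono/subsetP => z; rewrite !inE.
    case: (eqVneq z v) => [->|_]; first by rewrite vX vY vP !orbT.
    by case: (z \in A1); case: (z \in X); case: (z \in Y); case: (z \in P).
  have U2 : rank (A2 :|: ((X :|: Y) :&: Q)) <=
      rank ((A2 :|: (X :&: Q)) :|: (A2 :|: (Y :&: (Q :\ v)))).
    apply/rank_mono/subsetP => z; rewrite !inE.
    case: (eqVneq z v) => [->|_]; first by rewrite vX vY vQ !orbT.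
    by case: (z \in A2); case: (z \in X); case: (z \in Y); case: (z \in Q).
  have I1 : rank (A1 :|: (((X :&: Y) :\ v) :&: P)) <=
      rank ((A1 :|: (X :&: (P :\ v))) :&: (A1 :|: (Y :&: P))).
    apply/rank_mono/subsetP => z; rewrite !inE; case: (z == v) => /=.
      by rewrite orbF => ->.
    by case: (z \in A1); case: (z \in X); case: (z \in Y); case: (z \in P).
  have I2 : rank (A2 :|: (((X :&: Y) :\ v) :&: Q)) <=
      rank ((A2 :|: (X :&: Q)) :&: (A2 :|: (Y :&: (Q :\ v)))).
    apply/rank_mono/subsetP => z; rewrite !inE; case: (z == v) => /=.
      by rewrite orbF => ->.
    by case: (z \in A2); case: (z \in X); case: (z \in Y); case: (z \in Q).
  move/okE: okPQ => okPQ; have := okPQ (X :|: Y); rewrite subUset sXB sYB => /(_ isT).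
  have := okPQ ((X :&: Y) :\ v).
  rewrite (subset_trans (subD1set _ _)) ?subIset ?sXB // => /(_ isT).
  have := cardsUI X Y; rewrite [#|X :&: Y|](cardsD1 v) inE vX vY.
  lia.
(* At [X = B] the two ranks add up to at least 2b, so both equal b. The four pieces have 2b elements
   in all, so neither union has an overlap. *)
have := okPQ B (subxx _); rewrite QE (setIidPr sPB) (setIidPr (subsetDl _ _)).
have cardB : #|B| = b by apply: base_card.
have := rank_le_base (A1 :|: P) A_in; have := rank_le_base (A2 :|: (B :\: P)) A_in.
rewrite -/b.
have := rank_le_card (A1 :|: P); have := rank_le_card (A2 :|: (B :\: P)).
have := cardsUI A1 P; have := cardsUI A2 (B :\: P); have := cardsID P B.
rewrite (setIidPr sPB).
have : #|A1| + #|A2| = b.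
  by rewrite -cardsUI disjoint_setI0 // cards0 addn0.
move=> cA cP c2 c1 r2 r1 s2 s1 tot; exists P; rewrite -!setI_eq0 -!cards_eq0.
by split=> //; [apply: (rank_base A_in); rewrite -/b| apply: (rank_base A_in); rewrite -/b| |]; lia.
Qed.

(** Exchange the elements of [B'] outside [X] for elements of [B]. No incoming element lies in [X],
    as the rank of [X] would be exceeded, so [B' :&: X] survives until the parts outside [X]
    agree. *)
Lemma swap_inside B B' X : B \in Bs -> B' \in Bs ->
  #|B :&: X| = rank X -> #|B' :&: X| = rank X -> (B' :&: X) :|: (B :\: X) \in Bs.
Proof.
have [_ _ exch] := M; move=> B_in B'_in rB.
move: {2}#|_| (erefl #|B' :\: X :\: B|) => n.
elim: n B' B'_in => [|n IHn] B' B'_in nE rB'.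
  suff <- : B' :\: X = B :\: X by rewrite setID.
  apply/eqP; rewrite eqEcard; apply/andP; split.
    apply/subsetP => z zB'X; have : z \notin B' :\: X :\: B.
      by move/eqP: nE; rewrite cards_eq0 => /eqP->; rewrite inE.
    by move: zB'X; rewrite !inE => /andP[-> ->]; rewrite !andbT negbK.
  by have := cardsID X B; have := cardsID X B'; rewrite (base_card B_in B'_in); lia.
have /card_gt0P[x] : 0 < #|B' :\: X :\: B| by rewrite nE.
rewrite !inE => /and3P[xB xX xB'].
have xB'B : x \in B' :\: B by rewrite inE xB.
have [y yBB' By_in] := exch _ _ B'_in B_in x xB'B.
move: (yBB'); rewrite inE => /andP[yB' yB].
have yX : y \notin X.
  apply/negP => yX; have := rank_ge X By_in; rewrite -rB'.
  suff -> : (y |: B' :\ x) :&: X = y |: (B' :&: X).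
    by rewrite cardsU1 inE (negbTE yB') ltnn.
  apply/setP => z; rewrite !inE; case: (eqVneq z y) => [->//|_] /=.
  by case: eqP => //= ->; rewrite (negbTE xX) andbF.
have sameX : (y |: B' :\ x) :&: X = B' :&: X.
  apply/setP => z; rewrite !inE; case: (eqVneq z y) => [->|_] /=.
    by rewrite (negbTE yX) andbF.
  by case: eqP => //= ->; rewrite (negbTE xX) andbF.
rewrite -sameX; apply: IHn; rewrite ?sameX //.
suff -> : (y |: B' :\ x) :\: X :\: B = (B' :\: X :\: B) :\ x.
  by move: nE; rewrite (cardsD1 x) !inE xB xX xB' => -[].
apply/setP => z; rewrite !inE; case: (eqVneq z y) => [->|_] /=.
  by rewrite yB !andbF.
by case: (z == x); rewrite ?andbF.
Qed.

(** By [rank_chain] some base attains the ranks of [C] and of [~: A] together, so the maximum over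
    bases of the deletion is the rank of [C] in the whole matroid. *)
Lemma minor_basesP A C S : [disjoint A & C] ->
  S \in minor_bases Bs A C <->
  exists B, [/\ B \in Bs, #|B :&: ~: A| = rank (~: A),
                #|B :&: C| = rank C & S = B :\: (A :|: C)].
Proof.
move=> dAC; have sCA : C \subset ~: A by rewrite subsets_disjoint setCK disjoint_sym.
have IC B : (B :\: A) :&: C = B :&: C.
  by rewrite setDE -setIA (setIidPr sCA).
have maxA B : B \in Bs -> [forall B' in Bs, #|B' :\: A| <= #|B :\: A|]
    = (#|B :&: ~: A| == rank (~: A)).
  move=> B_in; apply/forall_inP/eqP => [maxB | rB B' B'_in].
    have [B' B'_in rB'] := rank_attained (~: A).
    by apply/eqP; rewrite eqn_leq rank_ge // -rB' -!setDE maxB.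
  by rewrite !setDE rB rank_ge.
have [B0 [B0_in rC0 rA0]] := rank_chain sCA.
have delP D : reflect (exists B, [/\ B \in Bs, #|B :&: ~: A| = rank (~: A) & D = B :\: A])
    (D \in del_bases Bs A).
  apply: (iffP imsetP) => [[B] | [B [B_in rB ->]]].
    by rewrite inE => /andP[B_in]; rewrite maxA // => /eqP rB ->; exists B.
  by exists B; rewrite // inE B_in maxA ?rB ?eqxx //.
split=> [/imsetP[D] | [B [B_in rA rC ->]]].
  rewrite inE => /andP[/delP[B [B_in rA ->]] /forall_inP maxC] ->.
  exists B; split=> //; last by rewrite setDDl.
  apply/eqP; rewrite eqn_leq rank_ge // -rC0 -[B :&: C]IC -[B0 :&: C]IC maxC //.
  by apply/delP; exists B0.
apply/imsetP; exists (B :\: A); last by rewrite setDDl.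
rewrite inE; apply/andP; split; first by apply/delP; exists B.
by apply/forall_inP => _ /delP[B' [B'_in _ ->]]; rewrite !IC rC rank_ge.
Qed.

(** One [J] serves all [S]: the part in [A :|: C] of a base attaining both ranks. It is grafted onto
    any other such base by swapping first inside [C], then inside [~: A]. *)
Lemma minor_bases_spanned A C : [disjoint A & C] ->
  exists2 J : {set T}, J \subset A :|: C & forall S, S \in minor_bases Bs A C -> J :|: S \in Bs.
Proof.
move=> dAC; have sCA : C \subset ~: A by rewrite subsets_disjoint setCK disjoint_sym.
have [B0 [B0_in rC0 rA0]] := rank_chain sCA.
exists (B0 :&: (A :|: C)); first exact: subsetIr.
move=> S /(minor_basesP _ dAC)[B [B_in rA rC ->]].
have B1_in := swap_inside B_in B0_in rC rC0.
have sub z : z \in C -> z \in A = false.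
  by move=> zC; have := subsetP sCA z zC; rewrite inE => /negbTE.
have cardB1 : #|((B0 :&: C) :|: (B :\: C)) :&: ~: A| = rank (~: A).
  rewrite -rA -(cardsID C) -[RHS](cardsID C).
  congr (_ + _); last first.
    by apply: eq_card => z; rewrite !inE; case: (z \in C); rewrite ?andbF.
  transitivity #|B0 :&: C|; last rewrite rC0 -rC; apply: eq_card => z; rewrite !inE;
    by case: (boolP (z \in C)) => [/sub->|]; rewrite ?andbF ?andbT ?orbF.
have := swap_inside B0_in B1_in rA0 cardB1.
set D := _ :|: _; set D' := _ :|: _; suff -> : D = D' by [].
apply/setP => z; rewrite !inE.
by case: (boolP (z \in C)) => [/sub->|]; case: (z \in A); case: (z \in B0); case: (z \in B).
Qed.
End Matroid.

(** * Pairs of complementary bases *)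

Definition bibase (T : finType) (Bs : {set {set T}}) (I U : {set T}) : pred {set T} :=
  fun S => [&& S \subset U, I :|: S \in Bs & I :|: (U :\: S) \in Bs].

Lemma bibaseC (T : finType) (Bs : {set {set T}}) (I U S : {set T}) :
  bibase Bs I U S -> bibase Bs I U (U :\: S).
Proof.
move=> /and3P[sSU S_in SC_in]; rewrite /bibase subsetDl SC_in.
by rewrite setDDr setDv set0U (setIidPr sSU).
Qed.

(** This is the shattering property. Multiple exchange splits [I :|: S] into [I :|: A] and [S :\: A]
    against the base [I :|: (U :\: S)]; the resulting [P] avoids [S], and [A :|: P] is the
    witness. *)
Lemma bibase_trace (T : finType) (E : {set T}) (Bs : {set {set T}}) (I U S A : {set T}) :
  is_matroid E Bs -> [disjoint I & U] -> bibase Bs I U S -> A \subset S ->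
  exists2 S', bibase Bs I U S' & S' :&: S = A.
Proof.
move=> M dIU /and3P[sSU S_in SC_in] sAS.
have IU z : z \in I -> z \in U = false by move=> /(disjointFr dIU).
have AS z : z \in A -> z \in S by apply: subsetP.
have SU z : z \in S -> z \in U by apply: subsetP.
have [||P] := multiple_exchange M (A1 := I :|: A) (A2 := S :\: A) _ _ SC_in.
- rewrite -setI_eq0; apply/eqP/setP => z; rewrite !inE.
  case: (boolP (z \in A)); rewrite ?andbF //= orbF.
  by case: (boolP (z \in I)) => //= /IU zU _; apply/negP => /SU; rewrite zU.
- by rewrite -setUA setUC setDE setUIr setUCr setIT (setUidPr sAS) setUC.
move=> [sPB P_in PC_in /pred0P dP dPC].
have PI z : z \in P -> (z \in I = false) * (z \in U) * (z \in S = false).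
  move=> zP; have := dP z; rewrite /= !inE zP andbT => /norP[/negbTE zI _].
  have := subsetP sPB z zP; rewrite !inE zI /= => /andP[/negbTE-> ->].
  by [].
exists (A :|: P).
  rewrite /bibase setUA P_in; apply/and3P; split=> //.
    by apply/subsetP => z; rewrite inE => /orP[/AS/SU|/PI[]] // [].
  suff <- : S :\: A :|: (I :|: U :\: S) :\: P = I :|: U :\: (A :|: P) by [].
  apply/setP => z; rewrite !inE.
  case: (boolP (z \in P)) => [/PI[[-> ->] ->]|_]; first by rewrite !andbF orbT.
  case: (boolP (z \in I)) => [_|_]; first by rewrite !orbT.
  case: (boolP (z \in A)) => [/AS->|_] //=.
  by case: (boolP (z \in S)) => [/SU->|_].
apply/setP => z; rewrite !inE.
case: (boolP (z \in P)) => [/PI[_ zS]|_].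
  by rewrite zS andbF; apply/esym/negbTE/negP => /AS; rewrite zS.
by rewrite orbF; case: (boolP (z \in A)) => // /AS->.
Qed.

Lemma bibase_card (T : finType) (E : {set T}) (Bs : {set {set T}}) (I U S S' : {set T}) :
  is_matroid E Bs -> [disjoint I & U] -> bibase Bs I U S -> bibase Bs I U S' ->
  #|S| = #|S'|.
Proof.
move=> M dIU.
have card S1 : bibase Bs I U S1 -> #|I :|: S1| = #|I| + #|S1|.
  move=> /and3P[sSU _ _]; rewrite cardsU disjoint_setI0 ?cards0 ?subn0 //.
  exact: disjointWr dIU.
move=> bS bS'; apply/(@addnI #|I|); rewrite -!card //.
by move: bS bS' => /and3P[_ S_in _] /and3P[_ S'_in _]; apply: base_card M _ _ _ _.
Qed.

(** Equality of multisets forces both sets to contain [B1 :&: B2] and to split the symmetric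
    difference; asking for [x] selects one of the two halves of each unordered pair. *)
Lemma Delta_bibase (T : finType) (Bs : {set {set T}}) (B1 B2 : {set T}) x :
  x \in B1 :\: B2 ->
  Delta Bs B1 B2 = #|[set S : {set T} | (x \in S) &&
    bibase Bs (B1 :&: B2) ((B1 :\: B2) :|: (B2 :\: B1)) S]|.
Proof.
set I := B1 :&: B2; set U := _ :|: _ => xB.
have xU : x \in U by rewrite inE xB.
have xI : x \notin I by move: xB; rewrite !inE => /andP[/negbTE-> _]; rewrite andbF.
pose pair S := [set I :|: S; I :|: (U :\: S)].
rewrite /Delta -(@card_in_imset _ _ pair); last first.
  move=> S S'; rewrite !inE => /andP[xS /and3P[sSU _ _]] /andP[xS' /and3P[sSU' _ _]].
  move=> eqp; have : I :|: S \in pair S' by rewrite -eqp !inE eqxx.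
  have UI Z z : z \in U -> z \in I :|: Z = (z \in Z).
    by rewrite !inE; case: (z \in B1); case: (z \in B2).
  have eqI (Z Z' : {set T}) : Z \subset U -> Z' \subset U -> I :|: Z = I :|: Z' -> Z = Z'.
    move=> sZ sZ' eqZ; apply/setP => z; case: (boolP (z \in U)) => zU.
      by rewrite -(UI Z) // eqZ UI.
    by rewrite (contraNF (subsetP sZ z)) // (contraNF (subsetP sZ' z)).
  rewrite !inE => /orP[] /eqP; first exact: eqI.
  by move/setP/(_ x); rewrite !UI // !inE xS xS'.
apply: eq_card => p; apply/imset2P/imsetP => [[D1 D2 D1_in]|[S]]; last first.
  rewrite inE => /andP[xS /and3P[sSU S_in SC_in]] ->.
  exists (I :|: S) (I :|: (U :\: S)) => //.
  rewrite inE SC_in; apply/forallP => z; have := subsetP sSU z; rewrite !inE.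
  by case: (z \in B1); case: (z \in B2); case: (z \in S) => // /(_ isT).
rewrite inE => /andP[D2_in /forallP Deq] ->.
have {}Deq z : (z \in D1) + (z \in D2) = (z \in B1) + (z \in B2) by apply/eqP.
wlog xD1 : D1 D2 D1_in D2_in Deq / x \in D1.
  move=> wl; case: (boolP (x \in D1)) => xD1; first exact: wl.
  rewrite setUC; apply: wl => // [z|]; first by rewrite addnC.
  by have := Deq x; move: xB; rewrite inE (negbTE xD1) => /andP[_ ->]; case: (x \in D2).
have E1 : I :|: (D1 :&: U) = D1.
  apply/setP => z; have := Deq z; rewrite !inE.
  by case: (z \in D1); case: (z \in D2); case: (z \in B1); case: (z \in B2).
have E2 : I :|: (U :\: (D1 :&: U)) = D2.
  apply/setP => z; have := Deq z; rewrite !inE.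
  by case: (z \in D1); case: (z \in D2); case: (z \in B1); case: (z \in B2).
exists (D1 :&: U); last by rewrite /pair E1 E2.
by rewrite inE [_ \in _ :&: _]inE xD1 xU /bibase subsetIr E1 E2 D1_in.
Qed.

(** * Counting subsets and recognizing uniform matroids *)

Lemma card_draws_with (T : finType) (U : {set T}) x k : x \in U ->
  #|[set S : {set T} | [&& x \in S, S \subset U & #|S| == k.+1]]| = 'C(#|U|.-1, k).
Proof.
move=> xU; have -> : #|U|.-1 = #|U :\ x| by rewrite (cardsD1 x U) xU.
rewrite -cards_draws -[RHS](@card_in_imset _ _ (setU [set x])); last first.
  move=> S S'; rewrite !inE !subsetD1 => /andP[/andP[_ xS] _] /andP[/andP[_ xS'] _].
  by move=> eqS; rewrite -(setU1K xS) -(setU1K xS') eqS.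
apply: eq_card => S; rewrite inE; apply/and3P/imsetP => [[xS sSU /eqP cS]|[S']].
  exists (S :\ x); last by rewrite setD1K.
  by rewrite inE setSD //=; move: cS; rewrite (cardsD1 x) xS add1n => -[->].
rewrite inE subsetD1 => /andP[/andP[sSU xS'] /eqP cS'] ->.
by rewrite setU11 subUset sub1set xU sSU cardsU1 xS' cS'.
Qed.

Lemma card_subsets_with (T : finType) (U : {set T}) x : x \in U ->
  #|[set S : {set T} | (x \in S) && (S \subset U)]| = 2 ^ #|U|.-1.
Proof.
move=> xU; have -> : #|U|.-1 = #|U :\ x| by rewrite (cardsD1 x U) xU.
rewrite -card_powerset -[RHS](@card_in_imset _ _ (setU [set x])); last first.
  move=> S S'; rewrite !inE !subsetD1 => /andP[_ xS] /andP[_ xS'].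
  by move=> eqS; rewrite -(setU1K xS) -(setU1K xS') eqS.
apply: eq_card => S; rewrite inE; apply/andP/imsetP => [[xS sSU]|[S']].
  by exists (S :\ x); rewrite ?setD1K // inE setSD.
rewrite inE subsetD1 => /andP[sSU xS'] ->.
by rewrite setU11 subUset sub1set xU sSU.
Qed.

Lemma iso_uniformP (T : finType) (r n : nat) (E : {set T}) (Bs : {set {set T}}) :
  iso_uniform r n E Bs <->
  #|E| = n /\ Bs = [set S : {set T} | (S \subset E) && (#|S| == r)].
Proof.
have img (f : 'I_n -> T) : injective f -> f @: [set: 'I_n] = E ->
    [set f @: S | S : {set 'I_n} in uniform_bases r n]
    = [set S : {set T} | (S \subset E) && (#|S| == r)].
  move=> inj_f fE; apply/setP => S; rewrite inE.
  apply/imsetP/andP => [[S']|[sSE /eqP cS]].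
    by rewrite inE => cS' ->; rewrite card_imset // -fE imsetS ?subsetT.
  have fS : S = f @: (f @^-1: S).
    apply/setP => z; apply/idP/imsetP => [zS|[i]]; last by rewrite inE => ? ->.
    have := subsetP sSE z zS; rewrite -fE => /imsetP[i _ zf].
    by exists i; rewrite // inE -zf.
  by exists (f @^-1: S); rewrite // inE -(card_imset _ inj_f) -fS cS.
split=> [[f [inj_f fE ->]]|[cE ->]].
  by split; [rewrite -fE card_imset // cardsT card_ord | apply: img].
subst n; pose f (i : 'I_#|E|) := enum_val i; exists f.
have fE : f @: [set: 'I_#|E|] = E.
  apply/eqP; rewrite eqEcard card_imset ?cardsT ?card_ord ?leqnn ?andbT; last first.
    exact: enum_val_inj.
  by apply/subsetP => _ /imsetP[i _ ->]; apply: enum_valP.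
by split; [apply: enum_val_inj | | rewrite img //; apply: enum_val_inj].
Qed.

(** * Bit sequences as subsets of an enumerated set *)

Section Subsequences.
Variables (T : finType) (s : seq T).
Hypothesis uniq_s : uniq s.

Definition subset_of (m : bitseq) : {set T} := [set z in mask m s].

Definition indicator (S : {set T}) : bitseq := [seq z \in S | z <- s].

Lemma mem_subset_of m z :
  (z \in subset_of m) = (z \in s) && nth false m (index z s).
Proof. by rewrite inE in_mask. Qed.

Lemma subset_of_indicator (S : {set T}) : {subset S <= s} -> subset_of (indicator S) = S.
Proof.
move=> sSs; apply/setP => z; rewrite inE -filter_mask mem_filter.
by case: (boolP (z \in S)) => // /sSs->.
Qed.

Lemma subset_ofK m : size m = size s -> indicator (subset_of m) = m.
Proof.
move=> size_m; apply: (@eq_from_nth _ false) => [|i]; rewrite size_map // => lti.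
have x : T by case: (s) lti.
by rewrite (nth_map x) // mem_subset_of mem_nth // index_uniq.
Qed.

Lemma subset_of_negb m : size m = size s ->
  subset_of (map negb m) = [set z in s] :\: subset_of m.
Proof.
move=> size_m; apply/setP => z; rewrite [in RHS]inE !mem_subset_of inE.
case: (boolP (z \in s)) => [zs|_]; last by rewrite andbF.
by rewrite (nth_map false) ?size_m ?index_mem ?andbT.
Qed.

Lemma card_subset_of m : size m = size s -> #|subset_of m| = count id m.
Proof.
by move=> size_m; rewrite cardsE (card_uniqP (mask_uniq uniq_s _)) size_mask.
Qed.
End Subsequences.

Lemma Delta_rank4 (T : finType) (E : {set T}) (Bs : {set {set T}}) (B1 B2 : {set T}) :
  is_matroid E Bs -> B1 \in Bs -> B2 \in Bs -> #|B1 :\: B2| = 4 ->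
  Delta Bs B1 B2 != 10.
Proof.
move=> M B1_in B2_in card12.
have /card_gt0P[x x12] : 0 < #|B1 :\: B2| by rewrite card12.
have card21 : #|B2 :\: B1| = 4.
  have := cardsID B2 B1; have := cardsID B1 B2.
  by rewrite (base_card M B1_in B2_in) setIC card12; lia.
rewrite (Delta_bibase _ x12); set I := B1 :&: B2; set U := _ :|: _.
(* With [x] first, sets containing [x] become the sequences with head [true], as in [halves]; with
   the rest of [B1 :\: B2] next, this set becomes the starting half of [count_halves_neq10]. *)
pose s1 := x :: enum ((B1 :\: B2) :\ x); pose s2 := enum (B2 :\: B1).
have mem_s1 : s1 =i B1 :\: B2.
  by move=> z; rewrite inE mem_enum in_setD1; case: eqP => [->|].
have size1 : size s1 = 4.
  by rewrite /= -cardE; move: card12; rewrite (cardsD1 x) x12 add1n.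
have size2 : size s2 = 4 by rewrite -cardE.
have uniq_s : uniq (s1 ++ s2).
  have uniq1 : uniq s1 by rewrite /= mem_enum in_setD1 eqxx enum_uniq.
  rewrite cat_uniq uniq1 enum_uniq andbT.
  apply/hasPn => z; rewrite mem_enum => /setDP[_]; apply: contra => z_s1.
  by have : z \in B1 :\: B2 by [rewrite -mem_s1]; case/setDP.
have size_s : size (s1 ++ s2) = 8 by rewrite size_cat size1 size2.
have mem_s : [set z in s1 ++ s2] = U.
  by apply/setP => z; rewrite inE mem_cat mem_s1 mem_enum -in_setU.
have sub_s (S : {set T}) : S \subset U -> {subset S <= s1 ++ s2}.
  by move=> sSU z /(subsetP sSU); rewrite -mem_s inE.
have dIU : [disjoint I & U].
  rewrite -setI_eq0; apply/eqP/setP => z; rewrite !inE.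
  by case: (z \in B1); case: (z \in B2).
have S0_bi : bibase Bs I U (B1 :\: B2).
  have UD : U :\: (B1 :\: B2) = B2 :\: B1.
    by apply/setP => z; rewrite !inE; case: (z \in B1); case: (z \in B2).
  by rewrite /bibase subsetUl UD setID /I setIC setID B1_in.
move: uniq_s size_s mem_s sub_s; move def_s: (s1 ++ s2) => s uniq_s size_s mem_s sub_s.
have index_x : index x s = 0 by rewrite -def_s /= eqxx.
have xs : x \in s by rewrite -def_s mem_head.
have phi_sub m : subset_of s m \subset U.
  by rewrite -mem_s; apply/subsetP => z; rewrite !inE => /mem_mask.
pose p m := bibase Bs I U (subset_of s m).
have -> : #|[set S : {set T} | (x \in S) && bibase Bs I U S]| = count p (halves 4).
  rewrite -size_filter -(size_map (subset_of s)).
  have uniq_phi : uniq (map (subset_of s) (filter p (halves 4))).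
    rewrite map_inj_in_uniq ?filter_uniq // => m m'.
    rewrite !(mem_filter p) !mem_halves //.
    move=> /andP[_ /andP[/eqP size_m _]] /andP[_ /andP[/eqP size_m' _]] eq_phi.
    by rewrite -(subset_ofK uniq_s (m := m)) ?size_s // eq_phi subset_ofK ?size_s.
  rewrite -(card_uniqP uniq_phi); apply: eq_card => S; rewrite inE.
  apply/andP/mapP => [[xS bS]|[m]].
    have sSs : {subset S <= s} by have /and3P[/sub_s] := bS.
    exists (indicator s S); last by rewrite subset_of_indicator.
    rewrite mem_filter /p subset_of_indicator // bS mem_halves //.
    rewrite size_map size_s -(card_subset_of uniq_s) ?size_map ?size_s //.
    rewrite subset_of_indicator // (bibase_card M dIU bS S0_bi) card12 !eqxx andbT.
    by rewrite -nth0 -{1}index_x (nth_map x) ?index_mem ?nth_index.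
  rewrite mem_filter mem_halves // => /and4P[bS _ xm _] ->; split=> //.
  by rewrite mem_subset_of // xs index_x nth0.
apply: count_halves_neq10.
- move=> m size_m; rewrite /p subset_of_negb ?size_s // mem_s.
  apply/idP/idP => /bibaseC //.
  by rewrite setDDr setDv set0U (setIidPr _).
- move=> m size_m pm.
  by rewrite -(card_subset_of uniq_s) ?size_s // (bibase_card M dIU pm S0_bi).
- move=> m a size_m pm; rewrite mem_submasks => /andP[/eqP size_a /eqP am].
  have nth_meet b i : size b = 8 -> nth false (meet b m) i = nth false b i && nth false m i.
    move=> size_b; case: (ltnP i 8) => lti.
      by rewrite (nth_map (false, false)) ?size_zip ?size_b ?size_m // nth_zip ?size_b.
    by rewrite !nth_default ?size_map ?size_zip ?size_b ?size_m.
  have sub_am : subset_of s a \subset subset_of s m.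
    apply/subsetP => z; rewrite !mem_subset_of // => /andP[->].
    by rewrite -am nth_meet ?size_a // => /andP[].
  have [S' bS' S'm] := bibase_trace M dIU pm sub_am.
  have sS's : {subset S' <= s} by have /and3P[/sub_s] := bS'.
  exists (indicator s S'); rewrite /p subset_of_indicator // size_map; split=> //.
  rewrite -[a](subset_ofK uniq_s) ?size_a ?size_m ?size_s // -S'm.
  apply: (@eq_from_nth _ false).
    by rewrite !size_map size_zip size_map size_m size_s.
  move=> i; rewrite size_map size_zip size_map size_m size_s => lti.
  rewrite nth_meet ?size_map // !(nth_map x) ?size_s // inE; congr (_ && _).
  by rewrite mem_subset_of // mem_nth ?size_s // index_uniq ?size_s.
- rewrite /p; suff -> : subset_of s [:: true; true; true; true; false; false; false; false]
      = B1 :\: B2 by [].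
  apply/setP => z; rewrite inE -def_s.
  rewrite -[[:: true; _; _; _; _; _; _; _]]/(nseq 4 true ++ nseq 4 false).
  by rewrite mask_cat ?size1 // mask_false cats0 mask_true ?size1.
Qed.

(** * Delta equal to 10 and the uniform minor *)

Lemma Delta_uniform (T : finType) (E : {set T}) (Bs : {set {set T}}) (J U : {set T}) :
  is_matroid E Bs -> [disjoint J & U] -> #|U| = 6 ->
  (forall S : {set T}, S \subset U -> #|S| = 3 -> J :|: S \in Bs) ->
  exists B1 B2, [/\ B1 \in Bs, B2 \in Bs & Delta Bs B1 B2 = 10].
Proof.
move=> M dJU cardU JS.
have [S0 sS0U card0] : exists2 S0 : {set T}, S0 \subset U & #|S0| = 3.
  have : 0 < #|[set S : {set T} | S \subset U & #|S| == 3]|.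
    by rewrite cards_draws cardU.
  by case/card_gt0P => S0; rewrite inE => /andP[sS0 /eqP]; exists S0.
have cardC (S : {set T}) : S \subset U -> #|S| = 3 -> #|U :\: S| = 3.
  by move=> sSU cS; rewrite cardsD (setIidPr sSU) cardU cS.
have JU z : z \in J -> z \in U = false by move=> /(disjointFr dJU).
have /card_gt0P[x xS0] : 0 < #|S0| by rewrite card0.
have SU z : z \in S0 -> z \in U by apply: subsetP.
have xU := SU x xS0.
exists (J :|: S0), (J :|: (U :\: S0)); split; rewrite ?JS ?subsetDl ?cardC //.
rewrite (@Delta_bibase _ _ _ _ x); last first.
  by rewrite !inE xS0 xU /= orbF orbT andbT; apply: contraL xU => /JU->.
have -> : (J :|: S0) :&: (J :|: U :\: S0) = J.
  rewrite -setUIr; apply/setUidPl/subsetP => z; rewrite !inE.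
  by case: (z \in S0).
have -> : (J :|: S0) :\: (J :|: U :\: S0) :|: (J :|: U :\: S0) :\: (J :|: S0) = U.
  apply/setP => z; rewrite !inE.
  case: (boolP (z \in J)) => [/JU->|_] //=.
  by case: (boolP (z \in S0)) => [/SU->|_]; case: (z \in U).
(* Every 3-subset of [U] qualifies, and those containing [x] are fixed by their other two
   elements. *)
rewrite -[10]/('C(6.-1, 2)) -cardU -(card_draws_with 2 xU).
have S0_bi : bibase Bs J U S0 by rewrite /bibase sS0U !JS ?subsetDl ?cardC.
apply: eq_card => S; rewrite !inE; congr (_ && _).
apply/idP/andP => [bS | [sSU /eqP cS]].
  have /and3P[sSU _ _] := bS.
  by rewrite (bibase_card M dJU bS S0_bi) card0.
by rewrite /bibase sSU !JS ?subsetDl ?cardC.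
Qed.

Lemma Delta10_card (T : finType) (E : {set T}) (Bs : {set {set T}}) (B1 B2 : {set T}) :
  is_matroid E Bs -> B1 \in Bs -> B2 \in Bs -> Delta Bs B1 B2 = 10 ->
  #|B1 :\: B2| = 3 /\
  (forall S : {set T}, S \subset (B1 :\: B2) :|: (B2 :\: B1) -> #|S| = 3 ->
     B1 :&: B2 :|: S \in Bs).
Proof.
move=> M B1_in B2_in D10.
have card21 : #|B2 :\: B1| = #|B1 :\: B2|.
  have := cardsID B2 B1; have := cardsID B1 B2.
  by rewrite (base_card M B1_in B2_in) setIC; lia.
set I := B1 :&: B2; set U := _ :|: _.
have dIU : [disjoint I & U].
  rewrite -setI_eq0; apply/eqP/setP => z; rewrite !inE.
  by case: (z \in B1); case: (z \in B2).
have cardU : #|U| = #|B1 :\: B2|.*2.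
  rewrite cardsU card21 addnn -[RHS]subn0; congr (_ - _); apply/eqP.
  rewrite cards_eq0; apply/eqP/setP => z; rewrite !inE.
  by case: (z \in B1); case: (z \in B2).
have UD : U :\: (B1 :\: B2) = B2 :\: B1.
  by apply/setP => z; rewrite !inE; case: (z \in B1); case: (z \in B2).
have S0_bi : bibase Bs I U (B1 :\: B2).
  by rewrite /bibase subsetUl UD setID /I setIC setID B1_in.
have [/eqP|/card_gt0P[x x12]] := posnP #|B1 :\: B2|.
  rewrite cards_eq0 => /eqP B12; have {}card21 : B2 :\: B1 = set0.
    by apply/eqP; rewrite -cards_eq0 card21 B12 cards0.
  have eqB : B1 = B2 by apply/eqP; rewrite eqEsubset -!setD_eq0 B12 card21 eqxx.
  (* When [B1 = B2], the multiset determines both members of the pair. *)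
  suff : Delta Bs B1 B2 <= 1 by rewrite D10.
  rewrite -(cards1 [set B1; B1]); apply/subset_leq_card/subsetP => _ /imset2P[D1 D2 _ + ->].
  rewrite !inE -eqB => /andP[_ /forallP Deq].
  have D z : (z \in D1 = (z \in B1)) * (z \in D2 = (z \in B1)).
    have /eqP := Deq z.
    by case: (z \in D1); case: (z \in D2); case: (z \in B1).
  suff [-> ->] : D1 = B1 /\ D2 = B1 by [].
  by split; apply/setP => z; rewrite D.
have xU : x \in U by rewrite inE x12.
move: D10; rewrite (Delta_bibase _ x12) -/I -/U => D10.
set F := [set S | _] in D10.
pose k := #|B1 :\: B2|; have k_gt0 : 0 < k by apply/card_gt0P; exists x.
pose F' := [set S : {set T} | [&& x \in S, S \subset U & #|S| == k.-1.+1]].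
have sFF' : F \subset F'.
  apply/subsetP => S; rewrite [S \in F]inE [S \in F']inE => /andP[-> bS].
  have /and3P[-> _ _] := bS; rewrite (bibase_card M dIU bS S0_bi) /= -/k.
  by rewrite prednK.
have cardF' : #|F'| = 'C(k.*2.-1, k.-1) by rewrite card_draws_with // cardU.
(* Each subset of [B1 :\: B2] containing [x] is the trace of some member of [F]. *)
have leF : 2 ^ k.-1 <= #|F|.
  rewrite -(card_subsets_with x12) (leq_trans _ (leq_imset_card (fun S => S :&: (B1 :\: B2)) _)) //.
  apply/subset_leq_card/subsetP => A; rewrite inE => /andP[xA sA].
  have [S bS SA] := bibase_trace M dIU S0_bi sA.
  apply/imsetP; exists S; rewrite // inE bS andbT.
  by move: xA; rewrite -SA inE => /andP[].
have := subset_leq_card sFF'; rewrite cardF' D10 => le10.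
have k3 : k = 3.
  have k_neq4 : k != 4.
    apply/eqP => k4; have := Delta_rank4 M B1_in B2_in k4.
    by rewrite (Delta_bibase _ x12) -/I -/U -/F D10.
  have k_lt5 : k < 5.
    rewrite ltnNge; apply: contraL leF => k5; rewrite -ltnNge D10.
    by rewrite (@leq_trans (2 ^ 4)) // leq_exp2l // -ltnS prednK.
  (* For k = 1 and k = 2 the binomial bound is 1 and 3, contradicting [le10]. *)
  by move: k k_gt0 k_neq4 k_lt5 le10 {sFF' cardF' leF F'} => [|[|[|[|[|]]]]].
split=> // S sSU cS.
have FF' : F = F' by apply/eqP; rewrite eqEcard sFF' cardF' D10 k3.
have bib (S1 : {set T}) : S1 \subset U -> #|S1| = 3 -> x \in S1 -> bibase Bs I U S1.
  move=> sS1 c1 xS1; have : S1 \in F by rewrite FF' inE xS1 sS1 c1 k3.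
  by rewrite inE => /andP[].
(* If [S] misses [x], its complement in [U] is a 3-subset containing [x], and a bibase yields both
   bases. *)
case: (boolP (x \in S)) => xS; first by have /and3P[] := bib S sSU cS xS.
have [||_ _] := and3P (bib (U :\: S) (subsetDl _ _) _ _).
- by rewrite cardsD (setIidPr sSU) cardU cS -/k k3.
- by rewrite inE xS.
by rewrite setDDr setDv set0U (setIidPr sSU).
Qed.

Theorem theorem3p5 (T : finType) (E : {set T}) (Bs : {set {set T}}) :
  is_matroid E Bs ->
  ((exists A C : {set T},
      [/\ A \subset E, C \subset E, [disjoint A & C] &
          iso_uniform 3 6 (minor_ground E A C) (minor_bases Bs A C)]) <->
   (exists B1 B2, [/\ B1 \in Bs, B2 \in Bs & Delta Bs B1 B2 = 10])).
Proof.
move=> M; have [_ sBE _] := M; split=> [[A [C [_ _ dAC /iso_uniformP[cardE' minorE]]]]|].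
  have [J sJ JS] := minor_bases_spanned M dAC.
  apply: (@Delta_uniform _ E _ J (minor_ground E A C)) => // [|S sS cS].
    rewrite disjoint_sym; apply: disjointWr sJ _.
    by rewrite -setI_eq0 /minor_ground setDE -setIA [~: _ :&: _]setIC setICr setI0.
  by apply: JS; rewrite minorE inE sS cS.
move=> [B1 [B2 [B1_in B2_in D10]]].
have [card12 Bs3] := Delta10_card M B1_in B2_in D10.
have s1E := sBE _ B1_in; have s2E := sBE _ B2_in.
set I := B1 :&: B2 in Bs3; set U := _ :|: _ in Bs3.
pose A := E :\: (B1 :|: B2).
have sIB : I \subset B1 by apply: subsetIl.
have dAC : [disjoint A & I].
  rewrite -setI_eq0; apply/eqP/setP => z; rewrite !inE.
  by case: (z \in B1); rewrite ?andbF.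
have UE z : z \in E :\: (A :|: I) = (z \in U).
  rewrite !inE; case zE: (z \in E).
    by case: (z \in B1); case: (z \in B2).
  by rewrite (contraFF (subsetP s1E z) zE) (contraFF (subsetP s2E z) zE).
have card21 : #|B2 :\: B1| = 3.
  have := cardsID B2 B1; have := cardsID B1 B2.
  by rewrite (base_card M B1_in B2_in) setIC; lia.
have cardU : #|U| = 6.
  rewrite cardsU card12 card21 -[6]subn0; congr (_ - _); apply/eqP.
  rewrite cards_eq0; apply/eqP/setP => z; rewrite !inE.
  by case: (z \in B1); case: (z \in B2).
exists A, I; split=> //; [exact: subsetDl | exact: subset_trans sIB s1E |].
apply/iso_uniformP; split; first by rewrite -cardU; apply: eq_card.
(* As [~: A] is spanning and [I] independent, the two rank conditions of [minor_basesP] say that [B]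
   avoids [A] and contains [I]. *)
have rA : rank Bs (~: A) = #|B1|.
  apply: (rank_spanning M B1_in); apply/subsetP => z zB.
  by rewrite !inE zB.
have rI : rank Bs I = #|I| by apply: (rank_independent M B1_in).
have cardB1 : #|B1| = #|I| + 3 by rewrite -card12 cardsID.
apply/setP => S; rewrite inE; apply/idP/andP.
  move=> /(minor_basesP M _ dAC)[B [B_in rBA rBI ->]].
  have sIB' : I \subset B.
    by apply/setIidPr/eqP; rewrite eqEcard subsetIr rBI rI leqnn.
  have sBA : B \subset ~: A.
    by apply/setIidPl/eqP; rewrite eqEcard subsetIl rBA rA (base_card M B_in B1_in) leqnn.
  split; first exact: setSD _ (sBE _ B_in).
  have /setDidPl BA : [disjoint B & A] by rewrite disjoints_subset.
  rewrite -setDDl BA.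
  by rewrite cardsD (setIidPr sIB') (base_card M B_in B1_in) cardB1 addKn.
move=> [sSE /eqP cS]; have sSU : S \subset U.
  by apply: subset_trans sSE _; apply/subsetP => z; rewrite UE.
apply/(minor_basesP M _ dAC); exists (I :|: S).
have B_in := Bs3 S sSU cS; split=> //.
- rewrite rA (base_card M B1_in B_in) -setDE (setDidPl _) // disjoints_subset.
  rewrite subUset -!disjoints_subset [X in X && _]disjoint_sym dAC disjoints_subset.
  by apply: subset_trans sSE _; rewrite /minor_ground setDE subIset // setCU subsetIl orbT.
- rewrite rI setIUl setIid; congr #|pred_of_set _|; apply/setUidPl.
  exact: subsetIr.
rewrite setDUl setDUr setDv setI0 set0U (setDidPl _) // disjoints_subset.
by apply: subset_trans sSE _; rewrite /minor_ground setDE subsetIr.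
Qed.
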